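(* Let $n\ge1$, $\sigma\in\mathrm{CCP}_{2n}$ and $P\in\mathcal{D}_n$. Let $\tau$ be the output of the Inverse Algorithm on input $(P,\sigma)$ and let $Q\in\mathcal{D}_n$ be the Dyck path whose tunneling is $\tau$. Then $\sigma(Q)=P$.
   Context: A Dyck path of size $n$ is a word $P_1\cdots P_{2n}$ in $\mathtt{u},\mathtt{d}$ with $n$ of each letter whose every prefix has at least as many $\mathtt{u}$'s as $\mathtt{d}$'s; $\mathcal{D}_n$ is their set. The tunneling $\tau_Q\in S_{2n}$ of $Q$ is the fixed-point-free involution pairing each up-step position with the position of its matching down-step. For $\sigma\in S_{2n}$, $\sigma_k=\sigma(k)$, $\sigma_{[k]}=\{\sigma_1,\dots,\sigma_k\}$; the $\sigma$-path $\sigma(Q)$ is the word with $\sigma(Q)_k=\mathtt{u}$ if $\tau_Q(\sigma_k)\notin\sigma_{[k]}$ and $\mathtt{d}$ otherwise. Arithmetic on $[2n]$ is modulo $2n$. A set $X\subseteq[2n]$ is a block of size $k$ if $X=\{x,\dots,x+k-1\}$ (mod $2n$) for some $x$; $x$ and $x+k-1$ are its endpoints. $\sigma$ is a CCP if $\sigma_{[k]}$ is a block of size $k$ for every $k\in[2n]$; $\mathrm{CCP}_{2n}$ is their set. Inverse Algorithm (input $P$, $\sigma\in\mathrm{CCP}_{2n}$): initially all elements of $[2n]$ are unpaired. For each $k\in[2n]$ with $P_k=\mathtt{d}$, in increasing order: (1) let $w$ be an endpoint of the block $\sigma_{[k-1]}$ cyclically adjacent to $\sigma_k$; (2) starting from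 $w$, traverse $\sigma_{[k-1]}$ (away from $\sigma_k$) to the first unpaired element $v$; (3) set $\tau(\sigma_k)=v$, $\tau(v)=\sigma_k$; (4) mark $\sigma_k, v$ paired. Output $\tau$ (which is the tunneling of a Dyck path). *)

(* Defs.v *)
From mathcomp Require Import all_boot all_fingroup zify.

Set Implicit Arguments.
Unset Strict Implicit.
Unset Printing Implicit Defensive.

(* Steps are booleans, [true] being the up-step u and [false] the down-step d.
   The set [2n] is rendered by 'I_(2 * n), i.e. positions are shifted to start
   at 0, and addition and subtraction of 1 modulo 2n are [ordS], [ord_pred]. *)
Notation U := true (only parsing).
Notation D := false (only parsing).

Definition is_dyck (n : nat) (w : seq bool) : bool :=
  [&& count_mem U w == n, count_mem D w == n
    & [forall k : 'I_(size w).+1,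
         count_mem D (take k w) <= count_mem U (take k w)]].

Section Tunneling.
Variable N : nat.
Implicit Types (w : N.-tuple bool) (i j k : 'I_N).

Definition between w (i j : nat) : seq bool := take (j - i.+1) (drop i.+1 w).

(* The up-step at i is matched with the down-step at j when the steps strictly
   between them form a (possibly empty) Dyck path. *)
Definition matched w i j : bool :=
  [&& i < j, tnth w i == U, tnth w j == D
    & is_dyck (count_mem U (between w i j)) (between w i j)].

Lemma dyck_prefix m (s : seq bool) (k : nat) :
  is_dyck m s -> count_mem D (take k s) <= count_mem U (take k s).
Proof.
case/and3P=> eU eD /forallP H; case: (leqP k (size s)) => hk.
  have hk' : k < (size s).+1 by [].
  exact: (H (Ordinal hk')).
by rewrite take_oversize ?(ltnW hk) // (eqP eU) (eqP eD).
Qed.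

Lemma between_cat w i j k : i < j -> j < k ->
  between w i k = between w i j ++ tnth w j :: between w j k.
Proof.
move=> ij jk; rewrite /between.
have -> : k - i.+1 = (j - i.+1) + (k - j.+1).+1 by lia.
rewrite takeD drop_drop.
have -> : (j - i.+1 + i.+1) = j by lia.
by rewrite [drop j w](drop_nth D) ?size_tuple //= (tnth_nth D).
Qed.

Lemma matched_injr w i j k : matched w i j -> matched w i k -> j = k.
Proof.
suff H j1 k1 : matched w i j1 -> matched w i k1 -> ~ j1 < k1.
  move=> mj mk; apply: val_inj => /=.
  by have := H _ _ mj mk; have := H _ _ mk mj; lia.
case/and4P=> ij _ /eqP wj Dj /and4P[ik _ _ Dk] jk.
have := dyck_prefix (size (between w i j1)).+1 Dk.
rewrite (between_cat w ij jk) -cat_rcons -(size_rcons _ (tnth w j1)).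
rewrite take_size_cat // -cats1 !count_cat wj /=.
by case/and3P: Dj => _ /eqP -> _; rewrite leq_add2l.
Qed.

Lemma matched_injl w i j k : matched w i k -> matched w j k -> i = j.
Proof.
suff H i1 j1 : matched w i1 k -> matched w j1 k -> ~ i1 < j1.
  move=> mi mj; apply: val_inj => /=.
  by have := H _ _ mi mj; have := H _ _ mj mi; lia.
move=> /and4P[ik _ _ Di] /and4P[jk /eqP wj _ Dj] ij.
have := dyck_prefix (size (between w i1 j1)) Di.
case/and3P: Di => _ /eqP + _; case/and3P: Dj => _ /eqP + _.
rewrite (between_cat w ij jk) take_size_cat // !count_cat wj /= => -> /eqP.
by rewrite add0n add1n addnS -addSn eqn_add2r => /eqP->; rewrite ltnn.
Qed.

Lemma matched_disj w i j k : matched w i j -> matched w k i -> False.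
Proof. by case/and4P=> _ /eqP wi _ _ /and4P[_ _]; rewrite wi. Qed.

(* The default value [i] only matters for words that are not Dyck paths. *)
Definition partner w i : 'I_N :=
  odflt i [pick j | matched w i j || matched w j i].

Lemma partner_involutive w : involutive (partner w).
Proof.
move=> i; rewrite {2}/partner; case: pickP => [j mij | /= ni]; last first.
  by rewrite /partner; case: pickP => // j; rewrite ni.
rewrite /= /partner; case: pickP => [k mjk /= | /(_ i)]; last by rewrite orbC mij.
case/orP: mij => mij; case/orP: mjk => mjk.
- by case: (matched_disj mjk mij).
- exact: matched_injl mjk mij.
- exact: matched_injr mjk mij.
- by case: (matched_disj mij mjk).
Qed.

Definition tunneling w : {perm 'I_N} := perm (inv_inj (@partner_involutive w)).

Implicit Types (sigma : {perm 'I_N}) (X : {set 'I_N}).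

Definition sigma_prefix sigma (k : nat) : {set 'I_N} :=
  [set sigma i | i : 'I_N & i < k].

(* [k : 'I_N] is the (k+1)-st position: [sigma_prefix sigma k.+1] contains
   [sigma k] itself. *)
Definition sigma_path sigma w : N.-tuple bool :=
  [tuple if tunneling w (sigma k) \notin sigma_prefix sigma k.+1
         then U else D | k < N].

Definition block (x : 'I_N) (k : nat) : {set 'I_N} :=
  [set iter i (@ordS N) x | i : 'I_k].

Definition is_block X (k : nat) : Prop := exists x, X = block x k.

Definition is_endpoint X (k : nat) (w : 'I_N) : Prop :=
  exists x, X = block x k /\ (w = x \/ w = iter k.-1 (@ordS N) x).

Definition is_CCP sigma : Prop :=
  forall k, 0 < k <= N -> is_block (sigma_prefix sigma k) k.

(* Partial pairings: [None] means unpaired. *)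
Definition pairing := {ffun 'I_N -> option 'I_N}.

Definition no_pairing : pairing := [ffun=> None].

Definition add_pair (tau : pairing) (a b : 'I_N) : pairing :=
  [ffun i => if i == a then Some b else if i == b then Some a else tau i].

Definition rotate (cw : bool) : 'I_N -> 'I_N :=
  if cw then @ordS N else @ord_pred N.

(* Steps (1) and (2) of the algorithm at the (k+1)-st position: the endpoint
   of the current block sigma_prefix sigma k (of size k) chosen next to
   [sigma k] is [rotate cw (sigma k)], the traversal goes on in the same
   direction [cw], hence away from [sigma k], and [v] is the first unpaired
   element met, after [j < k] paired ones.  Both values of [cw] are possible
   when [sigma k] is adjacent to both endpoints. *)
Definition selects sigma (tau : pairing) (k v : 'I_N) : Prop :=
  exists (cw : bool) (w : 'I_N) (j : nat),
    [/\ is_endpoint (sigma_prefix sigma k) k w, w = rotate cw (sigma k),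
        j < k /\ v = iter j (rotate cw) w, tau v = None
      & forall i, i < j -> tau (iter i (rotate cw) w) <> None].

(* [IA_run P sigma k tau]: some execution of the Inverse Algorithm has current
   pairing [tau] once the first k positions have been processed. *)
Inductive IA_run (P : N.-tuple bool) sigma : nat -> pairing -> Prop :=
| IA_init : IA_run P sigma 0 no_pairing
| IA_up (k : 'I_N) tau :
    IA_run P sigma k tau -> tnth P k = U -> IA_run P sigma k.+1 tau
| IA_down (k v : 'I_N) tau :
    IA_run P sigma k tau -> tnth P k = D -> selects sigma tau k v ->
    IA_run P sigma k.+1 (add_pair tau (sigma k) v).

Definition IA_output (P : N.-tuple bool) sigma (tau : pairing) : Prop :=
  IA_run P sigma N tau.

Definition is_tunneling_of (tau : pairing) w : Prop :=
  forall i, tau i = Some (tunneling w i).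

End Tunneling.

(* Main.v *)
From mathcomp Require Import all_boot all_fingroup zify.
Require Import Defs.

(* Unroll the circle, so that the current block becomes an integer interval that
   grows by one element at its left or right end at each step.  Along a run,
   every element lying between two paired elements of this interval is itself
   paired, with an element also lying between them: the pair added by a
   down-step encloses only paired elements, and one of them paired with an
   element beyond [v] would enclose the unpaired [v].  Since the number of
   unpaired elements of the block is the height of [P], the algorithm never gets
   stuck and ends with a noncrossing perfect matching, which is the tunneling of
   the Dyck path whose up-steps are the smaller elements of the pairs.  A
   down-step of [P] pairs [sigma k] with an earlier element, whereas at an
   up-step [sigma k] stays unpaired and can only be paired with a later one;
   this says that the sigma-path is [P]. *)

(** * Noncrossing involutions and Dyck paths *)

Section InvolutionToDyck.
Variables (N : nat) (f : 'I_N -> 'I_N).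
Hypothesis fK : involutive f.
Hypothesis f_neq : forall i, f i != i.

Definition openers : N.-tuple bool := [tuple i < f i | i < N].

(** Turns letter counts of a factor into cardinals of sets of positions, which can be compared
    through the injection [f]. *)
Lemma count_window (a : pred bool) (Q : N.-tuple bool) (x m : nat) :
  x + m <= N ->
  count a (take m (drop x Q)) = #|[set i : 'I_N | x <= i < x + m & a (tnth Q i)]|.
Proof.
elim: m => [|m IH] le_xmN.
  rewrite take0 /=; apply/esym/eqP; rewrite cards_eq0; apply/eqP/setP => i.
  by rewrite !inE; lia.
have lt_xmN : x + m < N by lia.
rewrite (take_nth true) ?size_drop ?size_tuple; last by lia.
rewrite -cats1 count_cat IH; last by lia.
rewrite nth_drop /= addn0; pose j := Ordinal lt_xmN.
have -> : nth true Q (x + m) = tnth Q j by rewrite (tnth_nth true).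
rewrite [in RHS](cardsD1 j) inE /= addnC; congr (_ + _).
  by congr nat_of_bool; rewrite (_ : x <= x + m < _ = true) //=; lia.
apply: eq_card => i; rewrite !inE -val_eqE /=.
by case: (a _); rewrite ?andbT ?andbF //; lia.
Qed.

Lemma opener_f i : tnth openers (f i) = ~~ tnth openers i.
Proof. by rewrite !tnth_mktuple fK; have := f_neq i; rewrite -val_eqE /=; lia. Qed.

(** The partner of a down-step lies before it, so [f] injects the down-steps of each prefix of the
    window into its up-steps. Over the whole window [f] also injects up-steps into down-steps. *)
Lemma closed_interval_dyck (x m : nat) :
  x + m <= N -> (forall i : 'I_N, x <= i < x + m -> x <= f i < x + m) ->
  is_dyck (count_mem true (take m (drop x openers))) (take m (drop x openers)).
Proof.
move=> le_xmN f_closed; set s := take m _.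
have prefix_le k : k <= m ->
    count_mem false (take k (drop x openers)) <=
    count_mem true (take k (drop x openers)).
  move=> le_km; rewrite !count_window; try lia.
  rewrite -(card_imset _ (can_inj fK)); apply: subset_leq_card.
  apply/subsetP => _ /imsetP[i + ->]; rewrite !inE opener_f => /andP[xi /eqP Di].
  rewrite Di eqxx andbT; have := f_closed i; move: Di.
  by rewrite tnth_mktuple; lia.
have size_s : size s = m by rewrite size_takel ?size_drop ?size_tuple; lia.
apply/and3P; split=> //.
  rewrite eqn_leq prefix_le // /s !count_window //.
  rewrite -(card_imset _ (can_inj fK)); apply: subset_leq_card.
  apply/subsetP => _ /imsetP[i + ->]; rewrite !inE opener_f.
  by case/andP=> xi /eqP ->; rewrite andbT; apply: f_closed.
apply/forallP => k; have le_km : k <= m by rewrite -size_s -ltnS.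
by rewrite /s take_takel ?prefix_le.
Qed.

Lemma openers_dyck n : N = 2 * n -> is_dyck n openers.
Proof.
move=> N2n; have := @closed_interval_dyck 0 N.
rewrite add0n drop0 take_oversize ?size_tuple // => /(_ (leqnn N)).
have closedN (i : 'I_N) : 0 <= i < N -> 0 <= f i < N.
  by move=> _; apply: ltn_ord.
move=> /(_ closedN) => dyckQ.
have := count_predC (pred1 true) openers; rewrite size_tuple.
rewrite (@eq_count _ (predC _) (pred1 false)); last by case.
case/and3P: (dyckQ) => _ /eqP -> _ => countN.
by rewrite (_ : n = count_mem true openers) //; lia.
Qed.

Hypothesis f_noncrossing : forall i u : 'I_N, i < u < f i -> i < f u < f i.

Lemma matched_openers (i : 'I_N) : i < f i -> matched openers i (f i).
Proof.
move=> lt_i; apply/and4P; split=> //; first by rewrite tnth_mktuple lt_i.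
  by rewrite opener_f tnth_mktuple lt_i.
have := ltn_ord (f i) => lt_fi.
apply: closed_interval_dyck => [|u ui]; first by lia.
by have := f_noncrossing i u; lia.
Qed.

Lemma tunneling_openers i : tunneling openers i = f i.
Proof.
rewrite permE /partner.
case: (ltnP i (f i)) => [lt_i | le_i].
  have mi := matched_openers i lt_i.
  case: pickP => [j /orP[mj|mj] | /(_ (f i))] /=.
  - exact: matched_injr mj mi.
  - by case: (matched_disj mi mj).
  - by rewrite mi.
have mi : matched openers (f i) i.
  have := matched_openers (f i); rewrite fK; apply.
  by have := f_neq i; rewrite -val_eqE /=; lia.
case: pickP => [j /orP[mj|mj] | /(_ (f i))] /=.
- by case: (matched_disj mj mi).
- exact: matched_injl mj mi.
- by rewrite mi orbT.
Qed.

End InvolutionToDyck.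

(** * Unrolling the circle *)

Section Unrolling.
Variables (N : nat) (N_gt0 : 0 < N).

Definition residue (t : nat) : 'I_N := Ordinal (ltn_pmod t N_gt0).

Local Notation e := residue.

Lemma ordS_residue t : ordS (e t) = e t.+1.
Proof. by apply: val_inj; rewrite /= -addn1 modnDml addn1. Qed.

Lemma ord_pred_residue t : ord_pred (e t.+1) = e t.
Proof. by rewrite -ordS_residue ordSK. Qed.

Lemma iter_ordS_residue j t : iter j (@ordS N) (e t) = e (t + j).
Proof. by elim: j => [|j IH]; rewrite ?addn0 //= IH ordS_residue addnS. Qed.

Lemma iter_ord_pred_residue j t : j <= t -> iter j (@ord_pred N) (e t) = e (t - j).
Proof.
elim: j => [|j IH] le_jt; rewrite ?subn0 //= IH; last by lia.
by rewrite (_ : t - j = (t - j.+1).+1) ?ord_pred_residue //; lia.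
Qed.

Lemma residue_inj lo s t :
  lo <= s < lo + N -> lo <= t < lo + N -> e s = e t -> s = t.
Proof.
wlog le_st : s t / s <= t => [IH s_in t_in est | s_in t_in /(congr1 val) /= est].
  by case/orP: (leq_total s t) => le; [|apply/esym]; apply: IH => //; apply/esym.
have /eqP : s + (t - s) = s + 0 %[mod N] by rewrite subnKC // addn0.
rewrite eqn_modDl mod0n modn_small; lia.
Qed.

Lemma residue_window lo (x : 'I_N) : exists2 t, lo <= t < lo + N & x = e t.
Proof.
have lt_x := ltn_ord x; have := ltn_pmod lo N_gt0 => lt_r.
have := divn_eq lo N => lo_eq; pose c := lo %/ N.
(* The representative of [x] in the period containing [lo], or in the next period if that one falls
   below [lo]. *)
exists (if x < lo %% N then c.+1 * N + x else c * N + x).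
  by rewrite /c mulSn; case: ifP; lia.
by apply: val_inj; rewrite /=; case: ifP => _; rewrite modnMDl modn_small.
Qed.

Lemma in_blockP lo k x :
  reflect (exists2 t, lo <= t < lo + k & x = e t) (x \in block (e lo) k).
Proof.
apply: (iffP imsetP) => [[i _ ->] | [t t_in ->]].
  by exists (lo + i); [have := ltn_ord i; lia | rewrite iter_ordS_residue].
have lt_tk : t - lo < k by lia.
by exists (Ordinal lt_tk) => //=; rewrite iter_ordS_residue subnKC //; lia.
Qed.

Lemma blockSr lo k : block (e lo) k.+1 = e (lo + k) |: block (e lo) k.
Proof.
apply/setP => x; rewrite in_setU1; apply/in_blockP/predU1P => [[t t_in ->] | []].
- case: (eqVneq t (lo + k)) => [-> | neq]; [by left | right].
  by apply/in_blockP; exists t => //; lia.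
- by move=> ->; exists (lo + k) => //; lia.
- by case/in_blockP => t t_in ->; exists t => //; lia.
Qed.

Lemma blockSl lo k : block (e lo) k.+1 = e lo |: block (e lo.+1) k.
Proof.
apply/setP => x; rewrite in_setU1; apply/in_blockP/predU1P => [[t t_in ->] | []].
- case: (eqVneq t lo) => [-> | neq]; [by left | right].
  by apply/in_blockP; exists t => //; lia.
- by move=> ->; exists lo => //; lia.
- by case/in_blockP => t t_in ->; exists t => //; lia.
Qed.

(** The circle is cut just before [lo]. The conclusion combines noncrossing with the absence of
    unpaired elements below a pair; the latter makes noncrossing survive a new pair. *)
Definition nested (lo : nat) (tau : pairing N) : Prop :=
  forall s t u, lo <= s -> s < u < t -> t < lo + N -> tau (e s) = Some (e t) ->
    exists2 u', s < u' < t & tau (e u) = Some (e u').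

Definition pairing_sym (tau : pairing N) : Prop :=
  forall a b, tau a = Some b -> tau b = Some a.

Lemma add_pairC (tau : pairing N) a b :
  a != b -> add_pair tau a b = add_pair tau b a.
Proof.
move=> neq; apply/ffunP => i; rewrite !ffunE.
by case: (eqVneq i a) => [->|//]; rewrite (negPf neq).
Qed.

(** An element below the new pair is paired by the last hypothesis; with a partner outside, that old
    pair would enclose [a] or [b], which are unpaired. *)
Lemma nested_add_pair lo (tau : pairing N) a b :
  pairing_sym tau -> nested lo tau -> lo <= a -> a < b -> b < lo + N ->
  tau (e a) = None -> tau (e b) = None ->
  (forall u, a < u < b -> tau (e u) <> None) ->
  nested lo (add_pair tau (e a) (e b)).
Proof.
move=> tau_sym nest le_a lt_ab lt_b tau_a tau_b full s t u le_s su_t lt_t.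
have e_inj x y : lo <= x < lo + N -> lo <= y < lo + N -> (e x == e y) = (x == y).
  by move=> x_in y_in; apply/eqP/eqP => [/(residue_inj lo)|->//]; apply.
rewrite !ffunE !e_inj; try lia.
case: eqP => [sa | _].
  move/Some_inj/eqP; rewrite e_inj; try lia.
  move=> /eqP bt; subst s t.
  case tau_u : (tau (e u)) => [y|]; last by case: (full u).
  have [u' u'_in y_eq] := residue_window lo y; subst y.
  have tau_u' := tau_sym _ _ tau_u.
  have neq_a : u' <> a by move=> eq; rewrite eq tau_a in tau_u'.
  have neq_b : u' <> b by move=> eq; rewrite eq tau_b in tau_u'.
  exists u'; last by have [/negPf-> /negPf->] : u != a /\ u != b by lia.
  apply/negPn/negP => out.
  have [lt_u'a|lt_bu'] : u' < a \/ b < u' by lia.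
    by have [] := nest u' u a; rewrite ?tau_a //; lia.
  by have [] := nest u u' b; rewrite ?tau_b //; lia.
case: eqP => [sb /Some_inj/eqP | _ tau_s]; first by rewrite e_inj; lia.
have [u' u'_in tau_u] := nest s t u le_s su_t lt_t tau_s; exists u' => //.
have neq_a : u <> a by move=> eq; rewrite eq tau_a in tau_u.
have neq_b : u <> b by move=> eq; rewrite eq tau_b in tau_u.
by have [/negPf-> /negPf->] : u != a /\ u != b by lia.
Qed.

(** The window gains [lo] and loses [lo + N], the same element of the circle; being unpaired, it
    cannot serve as [s]. *)
Lemma nested_shift lo (tau : pairing N) :
  tau (e lo) = None -> nested lo.+1 tau -> nested lo tau.
Proof.
move=> tau_lo nest s t u le_s su_t lt_t tau_s.
have neq : s <> lo by move=> eq; rewrite eq tau_lo in tau_s.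
by apply: nest => //; lia.
Qed.

(** Whether two chords cross does not depend on where the circle is cut. *)
Lemma nested_noncrossing lo (tau : pairing N) (f : 'I_N -> 'I_N) :
  nested lo tau -> (forall i, tau i = Some (f i)) -> involutive f ->
  forall i u : 'I_N, i < u < f i -> i < f u < f i.
Proof.
move=> nest tau_f fK.
have [M [r [lo_eq lt_r eM]]] : exists M r,
    [/\ lo = M + r, r < N & forall i, e (M + i) = e i].
  exists (lo %/ N * N), (lo %% N); rewrite -divn_eq ltn_pmod //; split=> // i.
  by apply: val_inj; rewrite /= modnMDl.
(* [shift] orders the circle starting from [r], the residue of [lo], by sending the elements below
   [r] behind the others. *)
pose shift (i : 'I_N) := if i < r then i + N else i.
have shiftK i : i = e (M + shift i).
  rewrite eM; apply: val_inj; rewrite /= /shift.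
  by case: ifP; rewrite ?modnDr modn_small.
have shift_in i : lo <= M + shift i < lo + N.
  by have := ltn_ord i; rewrite /shift; case: ifP; lia.
have shift_nest i u : shift i < shift u < shift (f i) ->
    shift i < shift (f u) < shift (f i).
  move=> iu; have i_in := shift_in i; have fi_in := shift_in (f i).
  have tau_i : tau (e (M + shift i)) = Some (e (M + shift (f i))).
    by rewrite -!shiftK.
  have := nest _ _ (M + shift u) _ _ _ tau_i; case; try lia.
  move=> u' u'_in; rewrite -shiftK tau_f => /Some_inj fu.
  move: (shiftK (f u)); rewrite {1}fu => /(residue_inj lo) fu_eq.
  by have := shift_in (f u); lia.
move=> i u iu.
have neq1 : f u <> i :> nat by move/val_inj => eq; move: iu; rewrite -eq fK; lia.
have neq2 : f u <> f i :> nat.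
  by move/val_inj/(can_inj fK) => eq; move: iu; rewrite eq; lia.
(* Moving the cut can reverse a pair and exchange its inside and outside, so nestedness is invoked
   for every choice of one end of each pair. *)
have := shift_nest i u; have := shift_nest (f i) u.
have := shift_nest i (f u); have := shift_nest (f i) (f u); rewrite !fK /shift.
have := ltn_ord i; have := ltn_ord u; have := ltn_ord (f i).
have := ltn_ord (f u); clear -iu neq1 neq2.
case: (ltnP i r) => ?; case: (ltnP u r) => ?; case: (ltnP (f i) r) => ?;
  case: (ltnP (f u) r) => ?; lia.
Qed.

End Unrolling.

(** * Growth of the blocks of [sigma] *)

Section InverseAlgorithm.
Variables (N : nat) (N_gt0 : 0 < N) (sigma : {perm 'I_N}).

Local Notation e := (residue N N_gt0).
Local Notation nested := (nested N N_gt0).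

Lemma sigma_in_prefix i k : (sigma i \in sigma_prefix sigma k) = (i < k).
Proof.
apply/imsetP/idP => [[j + /perm_inj ->] | lt_ik]; first by rewrite inE.
by exists i; rewrite ?inE.
Qed.

Lemma sigma_prefixS (k : 'I_N) :
  sigma_prefix sigma k.+1 = sigma k |: sigma_prefix sigma k.
Proof.
apply/setP => x; have [i ->] : exists i, x = sigma i.
  by exists (sigma^-1%g x); rewrite permKV.
rewrite in_setU1 !sigma_in_prefix (inj_eq perm_inj) -val_eqE /=; lia.
Qed.

(* The inequality leaves room for [lo] to decrease at every later step without
   truncation at 0. *)
Definition placed (lo k : nat) : Prop :=
  N < lo + k /\ sigma_prefix sigma k = block (e lo) k.

Lemma placed_left lo (k : 'I_N) :
  placed lo.+1 k -> sigma k = e lo -> placed lo k.+1.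
Proof.
by case=> lt_N prefix_k sk; split; [lia | rewrite sigma_prefixS blockSl sk prefix_k].
Qed.

Lemma placed_right lo (k : 'I_N) :
  placed lo k -> sigma k = e (lo + k) -> placed lo k.+1.
Proof.
by case=> lt_N prefix_k sk; split; [lia | rewrite sigma_prefixS blockSr sk prefix_k].
Qed.

(** [sigma k] lies outside the block and its successor inside, which happens only at the left
    end. *)
Lemma left_neighbour lo (k : 'I_N) :
  placed lo k -> ordS (sigma k) \in sigma_prefix sigma k ->
  exists2 lo', lo = lo'.+1 & sigma k = e lo'.
Proof.
case=> lt_N prefix_k; rewrite prefix_k => /in_blockP[t t_in sk].
have lt_k := ltn_ord k.
have {}sk : sigma k = e t.-1.
  by apply: ordS_inj; rewrite sk ordS_residue prednK //; lia.
have := sigma_in_prefix k k; rewrite ltnn prefix_k => /in_blockP out.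
case: (eqVneq t lo) => [tlo | neq]; last first.
  by case: out; exists t.-1 => //; lia.
by exists lo.-1; [lia | rewrite sk tlo].
Qed.

Lemma right_neighbour lo (k : 'I_N) :
  placed lo k -> ord_pred (sigma k) \in sigma_prefix sigma k ->
  sigma k = e (lo + k).
Proof.
case=> lt_N prefix_k; rewrite prefix_k => /in_blockP[t t_in sk].
have {}sk : sigma k = e t.+1 by rewrite -ordS_residue -sk ord_predK.
have := sigma_in_prefix k k; rewrite ltnn prefix_k => /in_blockP out.
case: (eqVneq t.+1 (lo + k)) => [<- // | neq].
by case: out; exists t.+1 => //; lia.
Qed.

(* In [is_CCP] the size ranges over ['I_N], so size [N] is not covered. *)
Lemma CCP_block k :
  is_CCP sigma -> 0 < k -> k <= N -> is_block (sigma_prefix sigma k) k.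
Proof.
move=> ccp k_gt0; rewrite leq_eqVlt => /predU1P[-> | lt_k]; last first.
  by apply: (ccp (Ordinal lt_k)); rewrite /= k_gt0 ltnW.
exists (e 0); apply/setP => x; rewrite -(permKV sigma x) sigma_in_prefix ltn_ord.
by apply/esym/in_blockP/residue_window.
Qed.

(** As [0 < k], [sigma k] has a neighbour within the block of size [k.+1]; this neighbour belongs to
    the old block, and its side tells which end grows. *)
Lemma placed_next lo (k : 'I_N) :
  is_CCP sigma -> 0 < k -> placed lo k ->
  (exists2 lo', lo = lo'.+1 & sigma k = e lo') \/ sigma k = e (lo + k).
Proof.
move=> ccp k_gt0 pl; have lt_k := ltn_ord k.
have [x prefix_k1] := CCP_block k.+1 ccp (ltn0Sn k) lt_k.
have [y _ x_eq] := residue_window N N_gt0 0 x; subst x.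
have : sigma k \in sigma_prefix sigma k.+1 by rewrite sigma_in_prefix.
rewrite prefix_k1 => /in_blockP[t t_in sk].
have other s : y <= s < y + k.+1 -> s != t -> e s \in sigma_prefix sigma k.
  move=> s_in neq; have : e s \in sigma_prefix sigma k.+1.
    by rewrite prefix_k1; apply/in_blockP; exists s.
  rewrite sigma_prefixS => /setU1P[|//]; rewrite sk.
  move/(residue_inj N N_gt0 y) => st; lia.
case: (eqVneq t y) => [ty | neq]; [left | right].
  by apply: left_neighbour => //; rewrite sk ordS_residue; apply: other; lia.
apply: right_neighbour => //; rewrite sk -(prednK (_ : 0 < t)); last by lia.
by rewrite ord_pred_residue; apply: other; lia.
Qed.

(** * Selecting the partner at a down-step *)

Lemma endpoint_in_prefix (k : nat) w :
  0 < k -> is_endpoint (sigma_prefix sigma k) k w -> w \in sigma_prefix sigma k.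
Proof.
move=> k_gt0 [x [-> w_eq]]; apply/imsetP.
have lt_k : k.-1 < k by lia.
by case: w_eq => ->; [exists (Ordinal k_gt0) | exists (Ordinal lt_k)].
Qed.

(** The direction [cw] fixes the end at which [sigma k] is placed, even when it is adjacent to both
    endpoints. The elements passed over are those between [sigma k] and [v], so [nested_add_pair]
    applies. *)
Lemma selects_nested lo (k v : 'I_N) (tau : pairing N) :
  pairing_sym N tau -> tau (sigma k) = None -> placed lo k -> nested lo tau ->
  selects sigma tau k v ->
  v \in sigma_prefix sigma k /\
  exists2 lo', placed lo' k.+1 & nested lo' (add_pair tau (sigma k) v).
Proof.
move=> tau_sym tau_k pl nest [cw [w [j [w_end w_eq [lt_jk v_eq] tau_v full]]]].
have lt_k := ltn_ord k; have [lt_N prefix_k] := pl.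
have w_in : w \in sigma_prefix sigma k by apply: endpoint_in_prefix => //; lia.
case: cw w_eq v_eq full => /= w_eq v_eq full.
  rewrite w_eq in w_in; have [lo' lo_eq sk] := left_neighbour lo k pl w_in.
  subst lo; rewrite sk ordS_residue in w_eq; subst w.
  rewrite iter_ordS_residue in v_eq; subst v; split.
    by rewrite prefix_k; apply/in_blockP; exists (lo'.+1 + j) => //; lia.
  exists lo'; first exact: placed_left.
  rewrite sk; apply: nested_add_pair => //; try lia.
  (* The cut moves left past [sigma k], which is still unpaired in [tau]. *)
  - by apply: nested_shift => //; rewrite -sk.
  - by rewrite -sk.
  - move=> u u_in; have lt_i : u - lo'.+1 < N by lia.
    have := full (Ordinal lt_i); rewrite iter_ordS_residue /= subnKC; last by lia.
    by apply; lia.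
rewrite w_eq in w_in; have sk := right_neighbour lo k pl w_in.
have lo_k : lo + k = (lo + k).-1.+1 by lia.
rewrite sk lo_k ord_pred_residue in w_eq; subst w.
rewrite iter_ord_pred_residue in v_eq; last by lia.
subst v; split.
  by rewrite prefix_k; apply/in_blockP; eexists; last by []; lia.
exists lo; first exact: placed_right.
(* [sigma k] is now the right end of the new pair, so the pair is turned around. *)
rewrite add_pairC.
  rewrite sk; apply: nested_add_pair => //; try lia.
  - by rewrite -sk.
  - move=> u u_in; have lt_i : (lo + k).-1 - u < N by lia.
    have := full (Ordinal lt_i); rewrite iter_ord_pred_residue /=; last by lia.
    by rewrite subKn; [apply | ]; lia.
by rewrite sk; apply/eqP => /(residue_inj N N_gt0 lo); lia.
Qed.

(** Started at the endpoint next to [sigma k], the traversal runs through the whole block and hence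
    meets [x]; the least index of an unpaired element gives [v]. *)
Lemma selects_exists lo (k : 'I_N) (tau : pairing N) :
  is_CCP sigma -> placed lo k ->
  (exists2 x, x \in sigma_prefix sigma k & tau x = None) ->
  exists v, selects sigma tau k v.
Proof.
move=> ccp pl [x + tau_x]; have [lt_N prefix_k] := pl.
rewrite prefix_k => /in_blockP[t t_in x_eq]; subst x.
have lt_k := ltn_ord k.
have first_unpaired (g : nat -> 'I_N) j0 : j0 < k -> tau (g j0) = None ->
    exists j, [/\ j < k, tau (g j) = None & forall i, i < j -> tau (g i) <> None].
  move=> lt_j0 /eqP g_j0; case: (@ex_minnP (fun j => tau (g j) == None)).
    by exists j0.
  move=> j /eqP g_j j_min; exists j; split=> // [|i lt_ij].
    by have := j_min _ g_j0; lia.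
  by move/eqP/j_min; lia.
have k_gt0 : 0 < k by lia.
case: (placed_next lo k ccp k_gt0 pl) => [[lo' lo_eq sk] | sk].
  subst lo; have [] := first_unpaired (fun j => iter j (rotate true) (e lo'.+1)) (t - lo'.+1).
  - by lia.
  - by rewrite iter_ordS_residue subnKC //; lia.
  move=> j [lt_j tau_j full]; eexists; exists true, (e lo'.+1), j; split=> //.
  - by exists (e lo'.+1); split; last left.
  - by rewrite sk /= ordS_residue.
  - by move=> i; apply: full.
have [] := first_unpaired (fun j => iter j (rotate false) (e (lo + k).-1)) ((lo + k).-1 - t).
- by lia.
- by rewrite iter_ord_pred_residue ?subKn //; lia.
move=> j [lt_j tau_j full]; eexists; exists false, (e (lo + k).-1), j; split=> //.
- exists (e lo); split=> //; right; rewrite iter_ordS_residue; congr residue; lia.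
- by rewrite sk /= -[in RHS](prednK (_ : 0 < lo + k)) ?ord_pred_residue //; lia.
- by move=> i; apply: full.
Qed.

(** * The invariant of a run *)

Variable P : N.-tuple bool.

(** [inv_count] equates the number of unpaired processed elements with the height of [P], avoiding
    subtraction. [inv_up] and [inv_down] will determine the sigma-path, [inv_nested] the noncrossing
    property. *)
Record run_invariant (k : nat) (tau : pairing N) : Prop := RunInvariant {
  inv_sym : pairing_sym N tau;
  inv_fresh : forall i : 'I_N, k <= i -> tau (sigma i) = None;
  inv_up : forall (i : 'I_N) a, tnth P i = true -> tau (sigma i) = Some a ->
    exists2 j : 'I_N, i < j & a = sigma j;
  inv_down : forall i : 'I_N, i < k -> tnth P i = false ->
    exists2 j : 'I_N, j < i & tau (sigma i) = Some (sigma j);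
  inv_count : #|[set i : 'I_N | (i < k) && (tau (sigma i) == None)]|
    + count_mem false (take k P) = count_mem true (take k P);
  inv_nested : exists2 lo, placed lo k & nested lo tau
}.

Lemma count_takeS (a : pred bool) (k : 'I_N) :
  count a (take k.+1 P) = count a (take k P) + a (tnth P k).
Proof.
rewrite (take_nth true) ?size_tuple // -cats1 count_cat /= addn0.
by rewrite (tnth_nth true).
Qed.

Lemma run_invariant0 : run_invariant 0 (no_pairing N).
Proof.
split=> [a b | i _ | i a _ | i // | | ]; rewrite ?ffunE //.
  by rewrite take0 /= addn0; apply/eqP; rewrite cards_eq0; apply/eqP/setP => i; rewrite !inE.
(* The block is empty, so any [lo] above [N] serves. *)
exists N.+1.
  split; first by lia.
  by apply/setP => x; apply/imsetP/imsetP => [[i] | [[]]] //; rewrite inE.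
by move=> s t u; rewrite ffunE.
Qed.

Lemma run_invariant_up (k : 'I_N) tau :
  is_CCP sigma -> run_invariant k tau -> tnth P k = true ->
  run_invariant k.+1 tau.
Proof.
move=> ccp [tau_sym fresh up down cnt [lo pl nest]] Pk.
split=> // [i lt_ki | i lt_i Pi | | ].
- by apply: fresh; lia.
- apply: down => //; move: lt_i; rewrite ltnS leq_eqVlt => /predU1P[eq|//].
  by rewrite (val_inj eq) Pk in Pi.
- rewrite !count_takeS Pk /= addn0 addn1 -cnt [in LHS](cardsD1 k) inE ltnSn fresh //=.
  rewrite add1n addSn; congr (_ + _).+1; apply: eq_card => i.
  by rewrite !inE -val_eqE /= andbA; congr (_ && _); lia.
case: (posnP k) => [k0 | k_gt0].
  (* Nothing is paired yet, so the position is chosen afresh: a multiple of [N] keeps the residue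
     and makes [lo] large enough for [placed]. *)
  exists (2 * N + sigma k).
    split; first by lia.
    rewrite sigma_prefixS k0 blockSr addn0.
    have -> : e (2 * N + sigma k) = sigma k.
      by apply: val_inj; rewrite /= modnMDl modn_small.
    congr (_ |: _); apply/setP => x.
    by apply/imsetP/imsetP => [[i] | [[]]] //; rewrite inE.
  move=> s t u _ _ _; have := fresh (sigma^-1%g (e s)).
  by rewrite permKV k0 => ->.
case: (placed_next lo k ccp k_gt0 pl) => [[lo' lo_eq sk] | sk].
  subst lo; exists lo'; first exact: placed_left.
  by apply: nested_shift => //; rewrite -sk fresh.
by exists lo; first exact: placed_right.
Qed.

Lemma run_invariant_down (k v : 'I_N) tau :
  run_invariant k tau -> tnth P k = false -> selects sigma tau k v ->
  run_invariant k.+1 (add_pair tau (sigma k) v).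
Proof.
move=> [tau_sym fresh up down cnt [lo pl nest]] Pk sel.
have tau_k := fresh k (leqnn k).
have [v_in geom] := selects_nested lo k v tau tau_sym tau_k pl nest sel.
have tau_v : tau v = None by case: sel => cw [w [j []]].
have [m v_eq] : exists m, v = sigma m by exists (sigma^-1%g v); rewrite permKV.
subst v; rewrite sigma_in_prefix in v_in.
(* Earlier down-steps are already paired, whereas [sigma m] is not. *)
have Pm : tnth P m = true.
  apply/negPn/negP => /negPf /(down m v_in)[j _].
  by rewrite tau_v.
have tau'E i : add_pair tau (sigma k) (sigma m) (sigma i) =
    if i == k then Some (sigma m) else if i == m then Some (sigma k)
    else tau (sigma i) by rewrite ffunE !(inj_eq perm_inj).
have neq_mk : (m == k) = false by rewrite -val_eqE /=; lia.
split=> // [a b | i lt_ki | i a Pi | i lt_i Pi | ].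
- have [i ->] : exists i, a = sigma i by exists (sigma^-1%g a); rewrite permKV.
  rewrite tau'E; case: (eqVneq i k) => [-> | neq_k].
    by case=> <-; rewrite tau'E neq_mk eqxx.
  case: (eqVneq i m) => [-> [<-] | neq_m tau_i]; first by rewrite tau'E eqxx.
  have tau_b := tau_sym _ _ tau_i; rewrite ffunE.
  case: eqP => [eq | _]; first by rewrite eq tau_k in tau_b.
  by case: eqP => [eq | _ //]; rewrite eq tau_v in tau_b.
- rewrite tau'E fresh; last by lia.
  by rewrite -!val_eqE /= !gtn_eqF //; lia.
- rewrite tau'E; case: (eqVneq i k) => [eq | _]; first by rewrite eq Pk in Pi.
  case: (eqVneq i m) => [-> [<-] | _]; first by exists k.
  exact: up.
- rewrite tau'E; case: (eqVneq i k) => [-> | neq_k]; first by exists m.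
  case: (eqVneq i m) => [eq | _]; first by rewrite eq Pm in Pi.
  by apply: down => //; move: neq_k; rewrite -val_eqE /=; lia.
rewrite !count_takeS Pk /= addn0 addn1 -cnt addnS -addSn; congr (_ + _).
(* [sigma m] leaves the set of unpaired elements and [sigma k] never joins it. *)
rewrite [in RHS](cardsD1 m) inE v_in tau_v eqxx /= add1n; congr _.+1.
apply: eq_card => i; rewrite !inE tau'E.
case: (eqVneq i k) => [-> | neq_k]; first by rewrite ltnn andbF /= andbF.
case: (eqVneq i m) => [_ | _]; first by rewrite andbF.
by rewrite /=; congr (_ && _); move: neq_k; rewrite -val_eqE /=; lia.
Qed.

Lemma IA_run_invariant k tau :
  is_CCP sigma -> IA_run P sigma k tau -> run_invariant k tau.
Proof.
move=> ccp; elim=> [|{}k {}tau _ | {}k v {}tau _].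
- exact: run_invariant0.
- exact: run_invariant_up.
- exact: run_invariant_down.
Qed.

Lemma IA_run_exists n k :
  is_CCP sigma -> is_dyck n P -> k <= N -> exists tau, IA_run P sigma k tau.
Proof.
move=> ccp dyckP; elim: k => [|k IH] lt_k; first by exists (no_pairing N); constructor.
have [tau run] := IH (ltnW lt_k); pose k' := Ordinal lt_k.
case Pk : (tnth P k'); first by exists tau; apply: (@IA_up _ _ _ k').
have [_ _ _ _ cnt [lo pl _]] := IA_run_invariant k tau ccp run.
have [v sel] : exists v, selects sigma tau k' v.
  apply: (selects_exists lo) => //.
  (* The prefix ending in this down-step has nonnegative height, so the height before it is positive
     and [inv_count] yields an unpaired element. *)
  have le_DU := dyck_prefix k.+1 dyckP.
  rewrite !(count_takeS _ k') Pk /= addn0 addn1 -cnt in le_DU.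
  move: le_DU; rewrite -[X in X < _]add0n ltn_add2r => /card_gt0P[i].
  rewrite inE => /andP[lt_ik /eqP tau_i].
  by exists (sigma i); rewrite ?sigma_in_prefix.
by exists (add_pair tau (sigma k') v); apply: (@IA_down _ _ _ k').
Qed.

(** The final height is 0, so [inv_count] leaves no unpaired element. *)
Lemma run_invariant_total n tau :
  is_dyck n P -> run_invariant N tau -> forall x, tau x <> None.
Proof.
case/and3P=> /eqP cntU /eqP cntD _ inv x tau_x.
have := inv_count _ _ inv; rewrite take_oversize ?size_tuple // cntU cntD.
rewrite (cardsD1 (sigma^-1%g x)) inE ltn_ord permKV tau_x eqxx; lia.
Qed.

End InverseAlgorithm.

(** * Reading the Dyck path and its sigma-path off the final pairing *)

Theorem theorem5 (n : nat) (sigma : {perm 'I_(2 * n)})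
    (P : (2 * n).-tuple bool) :
  1 <= n -> is_CCP sigma -> is_dyck n P ->
  (exists tau : pairing (2 * n), IA_output P sigma tau) /\
  (forall tau : pairing (2 * n), IA_output P sigma tau ->
     (exists Q : (2 * n).-tuple bool, is_dyck n Q /\ is_tunneling_of tau Q) /\
     (forall Q : (2 * n).-tuple bool,
        is_dyck n Q -> is_tunneling_of tau Q -> sigma_path sigma Q = P)).
Proof.
move=> n_gt0 ccp dyckP; have N_gt0 : 0 < 2 * n by lia.
split=> [|tau run]; first exact: (IA_run_exists _ N_gt0 _ _ n).
have inv := IA_run_invariant _ N_gt0 _ _ _ _ ccp run.
have total := run_invariant_total _ _ _ _ _ _ dyckP inv.
have [tau_sym _ up down _ [lo _ nest]] := inv.
split=> [|Q _ tunQ].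
  (* The default [x] never occurs, [tau] being total. *)
  pose f x := odflt x (tau x).
  have tau_f x : tau x = Some (f x).
    by rewrite /f; case tau_x : (tau x) => [y|] //; case: (total x).
  have fK : involutive f.
    by move=> x; have := tau_sym _ _ (tau_f x); rewrite tau_f => /Some_inj.
  (* By [up] and [down], partners have different indices under [sigma]. *)
  have f_neq x : f x != x.
    have [i ->] : exists i, x = sigma i by exists (sigma^-1%g x); rewrite permKV.
    have tau_i := tau_f (sigma i); apply/eqP => fi; rewrite fi in tau_i.
    case Pi : (tnth P i).
      by have [j lt_ij /perm_inj eq] := up _ _ Pi tau_i; rewrite eq ltnn in lt_ij.
    have [j lt_ji] := down i (ltn_ord i) Pi.
    by rewrite tau_i => /Some_inj/perm_inj eq; rewrite eq ltnn in lt_ji.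
  exists (openers _ f); split; first exact: openers_dyck.
  move=> i; rewrite tunneling_openers //.
  exact: (nested_noncrossing _ _ _ _ _ nest).
(* Position [k] looks at the prefix of size [k.+1], which contains the partner [sigma j] exactly
   when [j <= k]. *)
apply: eq_from_tnth => k; rewrite tnth_mktuple.
case Pk : (tnth P k).
  have [j lt_kj ->] := up _ _ Pk (tunQ (sigma k)).
  by rewrite sigma_in_prefix ltnS -ltnNge lt_kj.
have [j lt_jk] := down k (ltn_ord k) Pk; rewrite tunQ => /Some_inj ->.
by rewrite sigma_in_prefix ltnS ltnW.
Qed.
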